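(* The following identity holds: $$\sum_{k=0}^\infty\frac{(63k^2+78k+22)\,8^k}{(2k+1)(6k+1)(6k+5)\binom{6k}{3k}}=\frac{3\pi}{2}.$$
   Context: Here $\binom{6k}{3k}$ is the usual binomial coefficient; the series is a convergent series of real numbers. *)

(* Defs.v *)
From Stdlib Require Import Reals.
From Coquelicot Require Import Coquelicot.

(* Main.v *)
Require Import Defs.
From Stdlib Require Import Reals Lra Lia.
From Coquelicot Require Import Coquelicot.
Open Scope R_scope.

(** Write [n = 3k].  The Beta integral gives
    [1 / ((2n+1) C(2n,n)) = RInt (x(1-x))^n] over the unit interval, and passing
    from [n] to [n+1] multiplies this number by [(n+1) / (2(2n+3))].  Matching
    coefficients of the quadratic numerator shows that the [k]-th term of the
    series is [3] times the sum of the integrals of [u^(3k)], [u^(3k+1)] and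
    [u^(3k+2)], where [u = 2x(1-x)] (lemma [term_as_three_moments]).  The
    strange-looking series is therefore the geometric series of [u], taken three
    terms at a time and integrated:
    [3 RInt 1/(1-u) = 3 RInt 1/(1-2x+2x^2) = 3 (atan 1 - atan (-1)) = 3 PI / 2].

    The exchange of sum and integral is made explicit by the tails
    [tail m = RInt u^m/(1-u)].  Consecutive tails differ by [RInt u^m], so the
    partial sums telescope, and [0 <= u <= 1/2] makes the tails tend to zero. *)

(** * Central binomial coefficients and Beta integrals *)

Lemma central_binomial_pos (m : nat) : 0 < Binomial.C (2 * m) m.
Proof.
  unfold Binomial.C, Rdiv.
  apply Rmult_lt_0_compat; [apply INR_fact_lt_0|].
  apply Rinv_0_lt_compat, Rmult_lt_0_compat; apply INR_fact_lt_0.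
Qed.

Lemma central_binomial_succ (m : nat) :
  Binomial.C (2 * S m) (S m)
  = 2 * (2 * INR m + 1) / (INR m + 1) * Binomial.C (2 * m) m.
Proof.
  unfold Binomial.C.
  replace (2 * S m - S m)%nat with (S m) by lia.
  replace (2 * m - m)%nat with m by lia.
  replace (2 * S m)%nat with (S (S (2 * m))) by lia.
  rewrite !fact_simpl, !mult_INR, !S_INR, mult_INR.
  pose proof (INR_fact_neq_0 m); pose proof (pos_INR m).
  simpl (INR 2); field; lra.
Qed.

Definition beta_moment (m : nat) : R := RInt (fun x => (x * (1 - x)) ^ m) 0 1.

Lemma ex_RInt_beta_moment (m : nat) : ex_RInt (fun x => (x * (1 - x)) ^ m) 0 1.
Proof.
  apply (ex_RInt_continuous (V := R_CompleteNormedModule)); intros x _.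
  apply (ex_derive_continuous (K := R_AbsRing) (V := R_NormedModule)).
  auto_derive; exact I.
Qed.

(** With [t = x(1-x)] one has [(1-2x)^2 = 1 - 4t], so the derivative of
    [t^(m+1) (1-2x)] is [(m+1) t^m - (4m+6) t^(m+1)]; its primitive vanishes at
    both ends of the interval. *)
Lemma beta_moment_succ (m : nat) :
  (INR m + 1) * beta_moment m = (4 * INR m + 6) * beta_moment (S m).
Proof.
  assert (H : is_RInt (fun x => (INR m + 1) * (x * (1 - x)) ^ m
                                - (4 * INR m + 6) * (x * (1 - x)) ^ S m) 0 1 0).
  { pose (F x := (x * (1 - x)) ^ S m * (1 - 2 * x)).
    replace 0 with (minus (F 1) (F 0)) at 2
      by (unfold F, minus, plus, opp; simpl; ring).
    apply (is_RInt_derive (V := R_CompleteNormedModule)); intros x _.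
    - unfold F; auto_derive; [exact I|].
      change (match m with 0%nat => 1 | S _ => INR m + 1 end) with (INR (S m)).
      rewrite S_INR; simpl pow; unfold Rminus; ring.
    - apply (ex_derive_continuous (K := R_AbsRing) (V := R_NormedModule)).
      auto_derive; exact I. }
  assert (H' := is_RInt_minus _ _ _ _ _ _
    (is_RInt_scal _ _ _ (INR m + 1) _ (RInt_correct _ _ _ (ex_RInt_beta_moment m)))
    (is_RInt_scal _ _ _ (4 * INR m + 6) _
       (RInt_correct _ _ _ (ex_RInt_beta_moment (S m))))).
  assert (E := eq_trans
    (eq_sym (is_RInt_unique (V := R_CompleteNormedModule) _ _ _ _ H'))
    (is_RInt_unique (V := R_CompleteNormedModule) _ _ _ _ H)).
  unfold minus, plus, opp, scal in E; simpl in E; unfold mult in E; simpl in E.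
  unfold beta_moment; simpl pow; lra.
Qed.

Lemma beta_moment_central_binomial (m : nat) :
  beta_moment m = / ((2 * INR m + 1) * Binomial.C (2 * m) m).
Proof.
  induction m as [|m IH].
  - unfold beta_moment; simpl pow; rewrite RInt_const.
    unfold Binomial.C, scal; simpl; unfold mult; simpl; field.
  - assert (Hrec := beta_moment_succ m).
    assert (Hm := pos_INR m); assert (HC := central_binomial_pos m).
    apply Rmult_eq_reg_l with (4 * INR m + 6); [|lra].
    rewrite <- Hrec, IH, central_binomial_succ, S_INR.
    field; repeat split; lra.
Qed.

(** After division by [8^k] the three Beta integrals carry the coefficients
    [3, 6, 12].  These solve the linear system obtained by comparing coefficients
    with [63k^2 + 78k + 22] once all three are expressed by the first, and it is
    their geometric ratio [2] that makes the integrands consecutive powers of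
    [2x(1-x)]. *)
Lemma term_as_three_moments (k : nat) :
  (63 * INR k ^ 2 + 78 * INR k + 22) * 8 ^ k
  / ((2 * INR k + 1) * (6 * INR k + 1) * (6 * INR k + 5)
     * Binomial.C (6 * k) (3 * k))
  = 3 * (2 ^ (3 * k) * beta_moment (3 * k)
         + 2 ^ S (3 * k) * beta_moment (S (3 * k))
         + 2 ^ S (S (3 * k)) * beta_moment (S (S (3 * k)))).
Proof.
  assert (H1 := beta_moment_succ (3 * k)).
  assert (H2 := beta_moment_succ (S (3 * k))).
  assert (H0 := beta_moment_central_binomial (3 * k)).
  assert (HC := central_binomial_pos (3 * k)).
  assert (Hk := pos_INR k).
  replace (2 * (3 * k))%nat with (6 * k)%nat in * by lia.
  assert (HI : INR (3 * k) = 3 * INR k) by (rewrite mult_INR; simpl; ring).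
  rewrite S_INR in H2; rewrite HI in *.
  set (b0 := beta_moment (3 * k)) in *.
  set (b1 := beta_moment (S (3 * k))) in *.
  set (b2 := beta_moment (S (S (3 * k)))) in *.
  assert (E1 : b1 = (3 * INR k + 1) * b0 / (4 * (3 * INR k) + 6))
    by (rewrite H1; field; lra).
  assert (E2 : b2 = (3 * INR k + 1 + 1) * b1 / (4 * (3 * INR k + 1) + 6))
    by (rewrite H2; field; lra).
  rewrite E2, E1, H0, <- !tech_pow_Rmult, pow_mult.
  replace (2 ^ 3) with 8 by ring.
  field; repeat split; lra.
Qed.

(** * Tails of the integrated geometric series *)

Definition tail (m : nat) : R :=
  RInt (fun x => (2 * (x * (1 - x))) ^ m / (1 - 2 * (x * (1 - x)))) 0 1.

Lemma tail_denominator_bound (x : R) : / 2 <= 1 - 2 * (x * (1 - x)).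
Proof. pose proof (pow2_ge_0 (2 * x - 1)); lra. Qed.

Lemma ex_RInt_tail (m : nat) :
  ex_RInt (fun x => (2 * (x * (1 - x))) ^ m / (1 - 2 * (x * (1 - x)))) 0 1.
Proof.
  apply (ex_RInt_continuous (V := R_CompleteNormedModule)); intros x _.
  apply (ex_derive_continuous (K := R_AbsRing) (V := R_NormedModule)).
  pose proof (tail_denominator_bound x).
  auto_derive; lra.
Qed.

(** The integrand is [1/(1-2x+2x^2)], with primitive [atan (2x-1)]. *)
Lemma tail_0 : tail 0 = PI / 2.
Proof.
  unfold tail; apply is_RInt_unique.
  pose (F x := atan (2 * x - 1)).
  replace (PI / 2) with (minus (F 1) (F 0)).
  2:{ unfold F, minus, plus, opp; simpl.
      replace (2 * 1 - 1) with 1 by ring; replace (2 * 0 - 1) with (Ropp 1) by ring.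
      rewrite atan_opp, atan_1; lra. }
  apply (is_RInt_derive (V := R_CompleteNormedModule)); intros x _;
    pose proof (tail_denominator_bound x).
  - unfold F; auto_derive; [exact I|].
    simpl pow; field; split; nra.
  - apply (ex_derive_continuous (K := R_AbsRing) (V := R_NormedModule)).
    auto_derive; lra.
Qed.

Lemma tail_sub_succ (m : nat) : tail m - tail (S m) = 2 ^ m * beta_moment m.
Proof.
  assert (H := is_RInt_minus _ _ _ _ _ _
    (RInt_correct _ _ _ (ex_RInt_tail m)) (RInt_correct _ _ _ (ex_RInt_tail (S m)))).
  assert (H' := is_RInt_scal _ _ _ (2 ^ m) _
                  (RInt_correct _ _ _ (ex_RInt_beta_moment m))).
  apply (is_RInt_ext _ (fun x => minus
    ((2 * (x * (1 - x))) ^ m / (1 - 2 * (x * (1 - x))))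
    ((2 * (x * (1 - x))) ^ S m / (1 - 2 * (x * (1 - x)))))) in H'.
  - exact (eq_trans (eq_sym (is_RInt_unique (V := R_CompleteNormedModule) _ _ _ _ H))
      (is_RInt_unique (V := R_CompleteNormedModule) _ _ _ _ H')).
  - intros x _; pose proof (tail_denominator_bound x).
    unfold minus, plus, opp, scal; simpl; unfold mult; simpl.
    rewrite <- Rpow_mult_distr; field; lra.
Qed.

(** On the unit interval [0 <= 2x(1-x) <= 1/2] and [1/(1-2x(1-x)) <= 2]. *)
Lemma tail_bounds (m : nat) : 0 <= tail m <= 2 * (/ 2) ^ m.
Proof.
  assert (Hu : forall x, 0 < x < 1 -> 0 <= 2 * (x * (1 - x)) <= / 2).
  { intros x Hx; pose proof (tail_denominator_bound x); nra. }
  split.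
  - apply RInt_ge_0; [lra | apply ex_RInt_tail |]; intros x Hx.
    pose proof (tail_denominator_bound x); specialize (Hu x Hx).
    apply Rmult_le_pos; [apply pow_le; lra | left; apply Rinv_0_lt_compat; lra].
  - replace (2 * (/ 2) ^ m) with (RInt (fun _ => 2 * (/ 2) ^ m) 0 1)
      by (rewrite RInt_const; unfold scal; simpl; unfold mult; simpl; ring).
    apply RInt_le; [lra | apply ex_RInt_tail | apply ex_RInt_const |]; intros x Hx.
    pose proof (tail_denominator_bound x); specialize (Hu x Hx).
    rewrite (Rmult_comm 2 ((/ 2) ^ m)); apply Rmult_le_compat.
    + apply pow_le; lra.
    + left; apply Rinv_0_lt_compat; lra.
    + apply pow_incr; lra.
    + rewrite <- (Rinv_inv 2); apply Rinv_le_contravar; lra.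
Qed.

Lemma is_lim_seq_tail : is_lim_seq tail 0.
Proof.
  apply (is_lim_seq_le_le (fun _ => 0) _ (fun m => 2 * (/ 2) ^ m)).
  - exact tail_bounds.
  - apply is_lim_seq_const.
  - replace (Finite 0) with (Rbar_mult 2 0) by (simpl; f_equal; ring).
    apply is_lim_seq_scal_l, is_lim_seq_geom.
    rewrite Rabs_pos_eq; lra.
Qed.

(** * The series *)

(* [Binomial.C] is the real-valued binomial coefficient; the short name [C]
   is shadowed by Coquelicot's complex numbers. *)
Theorem theorem1p1 :
  is_series
    (fun k : nat =>
       (63 * INR k ^ 2 + 78 * INR k + 22) * 8 ^ k
       / ((2 * INR k + 1) * (6 * INR k + 1) * (6 * INR k + 5)
          * Binomial.C (6 * k) (3 * k)))
    (3 * PI / 2).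
Proof.
  apply (is_series_ext (fun k => 3 * (tail (3 * k) - tail (3 * S k)))).
  { intros k; rewrite term_as_three_moments, <- !tail_sub_succ.
    replace (3 * S k)%nat with (S (S (S (3 * k)))) by lia.
    apply (Rmult_eq_compat_l 3); ring. }
  apply (is_lim_seq_ext (fun N => 3 * (tail 0 - tail (3 * S N))) _
           (Finite (3 * PI / 2))).
  { intros n; induction n as [|n IH].
    - rewrite sum_O; reflexivity.
    - rewrite sum_Sn, <- IH.
      change (3 * (tail 0 - tail (3 * S (S n)))
              = 3 * (tail 0 - tail (3 * S n))
                + 3 * (tail (3 * S n) - tail (3 * S (S n)))); ring. }
  replace (Finite (3 * PI / 2)) with (Rbar_mult 3 (Finite (PI / 2 - 0)))
    by (simpl; f_equal; field).
  apply is_lim_seq_scal_l; rewrite tail_0.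
  apply is_lim_seq_minus'; [apply is_lim_seq_const|].
  apply (is_lim_seq_subseq tail 0 (fun N => (3 * S N)%nat)); [|exact is_lim_seq_tail].
  apply eventually_subseq; intros n; lia.
Qed.
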